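(* Let $G=(V,E)$ be a non-bipartite, finite, simple, connected graph with $n=|V|$. For every $\delta\in(0,2)$, $$\mu^{\mathcal Q}(\delta)<(4000\,\delta)^{1/3}.$$ Consequently, $\lambda_k^P\ge-1+\frac{k^3}{4000n^3}$ for $1\le k\le n$. Furthermore, for integers $t\ge1$, $$0\le\frac{\sum_{x\in V}p_t(x,x)-1}{n}\le\frac{30}{t^{1/3}}\ \text{ if } t\text{ is even},\qquad \frac{\left|\sum_{x\in V}p_t(x,x)-1\right|}{n}\le\frac{15}{t^{1/3}}\ \text{ if } t\text{ is odd}.$$
   Context: Graphs are undirected and unweighted; $d(x)$ is the degree of $x$. Simple random walk moves from a vertex to a uniformly random neighbour; $p_t(x,y)$ is its $t$-step transition probability. $\ell^2(V,d)$ is the space of functions on $V$ with $\langle f,g\rangle_d=\sum_x d(x)f(x)\overline{g(x)}$. The transition operator is $(Pf)(x)=\frac1{d(x)}\sum_{y\sim x}f(y)$, self-adjoint on $\ell^2(V,d)$, with eigenvalues $\lambda_1^P\le\dots\le\lambda_n^P=1$ (with multiplicity); $\mathcal Q=I+P$. With $I_{\mathcal Q}([0,\delta])$ the spectral projection of $\mathcal Q$ for $[0,\delta]$ and $\mathbf e_x=\mathbf 1_x/\sqrt{d(x)}$, set $\mu_x^{\mathcal Q}(\delta)=\langle I_{\mathcal Q}([0,\delta])\mathbf e_x,\mathbf e_x\rangle_d$; the average spectral measure is $\mu^{\mathcal Q}(\delta)=\frac1n\sum_{x\in V}\mu_x^{\mathcal Q}(\delta)$. *)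

(* Defs.v *)
From HB Require Import structures.
From mathcomp Require Import all_boot all_order all_algebra.

Set Implicit Arguments.
Unset Strict Implicit.
Unset Printing Implicit Defensive.

Import Order.TTheory GRing.Theory Num.Theory.

Local Open Scope ring_scope.

Definition bipartite (V : finType) (e : rel V) : Prop :=
  exists side : V -> bool, forall x y, e x y -> side x != side y.

Definition connected_graph (V : finType) (e : rel V) : Prop :=
  forall x y, connect e x y.

Section Eigenvalues.
Variables (C : numClosedFieldType) (vT : vectType C) (A : 'End(vT)).

(* The roots of the characteristic polynomial, repeated according to their
   multiplicity; <=%R is only a partial order on C, but it is total on the
   real numbers, where all the eigenvalues of a self-adjoint operator lie. *)
Definition eigenvalues : seq C :=
  let b := vbasis {:vT} in
  sort <=%R (sval (closed_field_poly_normal (char_poly (passmx.mxof b b A)))).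

Definition eigenspan (B : pred C) : {vspace vT} :=
  (\sum_(a <- eigenvalues | B a) passmx.leigenspace A a)%VS.

End Eigenvalues.

Section WeightedL2.
Variables (C : numClosedFieldType) (V : finType) (e : rel V).

Notation l2 := {ffun V -> C^o}.

Definition deg (x : V) : nat := #|[set y | e x y]|.

Definition dotd (f g : l2) : C := \sum_x (deg x)%:R * f x * (g x)^*.

Definition dotdr (g f : l2) : C^o := dotd f g.

Lemma dotdr_linear (g : l2) : linear (dotdr g).
Proof.
move=> a f h; rewrite /dotdr /dotd scaler_sumr -big_split /=.
apply: eq_bigr => x _; rewrite !ffunE mulrDr mulrDl; congr (_ + _).
by rewrite /GRing.scale /= !mulrA (mulrC a).
Qed.

HB.instance Definition _ (g : l2) :=
  GRing.isLinear.Build C l2 C^o _ (dotdr g) (dotdr_linear g).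

Definition orthod (U : {vspace l2}) : {vspace l2} :=
  (\bigcap_(g <- vbasis U) lker (linfun (dotdr g)))%VS.

(* The projection onto the eigenspan along its dotd-orthogonal; dotd is positive
   definite only when there is no isolated vertex. *)
Definition spectral_proj (A : 'End(l2)) (B : pred C) : 'End(l2) :=
  daddv_pi (eigenspan A B) (orthod (eigenspan A B)).

Definition transition_fun (f : l2) : l2 :=
  [ffun x => (deg x)%:R^-1 * \sum_(y | e x y) f y].

Lemma transition_linear : linear transition_fun.
Proof.
move=> a f g; apply/ffunP => x; rewrite !ffunE.
rewrite /GRing.scale /= mulrCA -mulrDr; congr (_ * _).
by rewrite mulr_sumr -big_split; apply: eq_bigr => y _; rewrite !ffunE.
Qed.

HB.instance Definition _ :=
  GRing.isLinear.Build C l2 l2 _ transition_fun transition_linear.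

Definition transP : 'End(l2) := linfun transition_fun.

Definition opQ : 'End(l2) := \1%VF + transP.

Definition unit_at (x : V) : l2 :=
  [ffun y => (y == x)%:R / sqrtC (deg x)%:R].

(* 0 <= z forces z to be real in the partial order of C. *)
Definition muQ_at (x : V) (delta : C) : C :=
  dotd (spectral_proj opQ [pred z | 0 <= z <= delta] (unit_at x)) (unit_at x).

Definition muQ (delta : C) : C := #|V|%:R^-1 * \sum_x muQ_at x delta.

End WeightedL2.

Section RandomWalk.
Variables (R : realFieldType) (V : finType) (e : rel V).

Definition step (x y : V) : R := if e x y then (deg e x)%:R^-1 else 0.

Fixpoint ptrans (t : nat) (x y : V) : R :=
  if t is t'.+1 then \sum_z step x z * ptrans t' z y else (x == y)%:R.

End RandomWalk.

(* Main.v *)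
Require Import Defs.
From mathcomp Require Import all_boot all_order all_algebra.
From mathcomp Require Import complex.
From mathcomp Require Import reals exp.
From mathcomp Require Import ring lra.

Set Implicit Arguments.
Unset Strict Implicit.
Unset Printing Implicit Defensive.

Import Order.TTheory GRing.Theory Num.Theory.

Local Open Scope ring_scope.

(* Let [S] be the set of the [k] eigenvectors [psi_i] of [P] with
   [1 + lambda_i <= delta], and embed [V] by [F x = (psi_i x)_(i in S)].  Then
   [\sum_x d(x) |F x|^2 = k], the energy [\sum_(x ~ y) |F x + F y|^2] is at most
   [2 delta k] (over ordered pairs), and Bessel's inequality says that the mass
   [d(x) |F x|^2] is spread over many directions.  Let [B_x] be the set of [y] with
   [F y] or [- F y] within [|F x| / 2] of [F x].  Choosing the center [x] with weight
   [mu_x = d(x) |F x|^2], every vertex is covered with weight at most [4 / 3].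
   If [x] has at least [d(x) / 2] neighbours outside [B_x], they carry energy
   [mu_x / 8]; otherwise [d(x) <= 2 #|B_x|], and a path in the bipartite double
   cover from [(x, +)] to [(x, -)], which exists because the graph is connected and
   not bipartite, leaves the ball after at most [#|B_x|] steps, so that the energy
   around [B_x] is at least [mu_x / (8 #|B_x|^2)] in both cases.  Averaging over [x]
   by means of the Cauchy-Schwarz inequality yields [k^3 <= 38 delta n^3].

   The same argument with [|F x - F y|^2] bounds the number of eigenvalues near
   [1], the embedding being centered; the traces of the powers of [P] are then
   bounded by summation over the eigenvalues on either side of [0]. *)

(** * Cauchy-Schwarz without square roots *)

Lemma cauchy_sum (R : realFieldType) (I : finType) (P : pred I) (c f g : I -> R) :
    (forall i, P i -> 0 <= f i) -> (forall i, P i -> 0 <= g i) ->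
    (forall i, P i -> c i ^+ 2 <= f i * g i) ->
  (\sum_(i | P i) c i) ^+ 2 <= (\sum_(i | P i) f i) * (\sum_(i | P i) g i).
Proof.
move=> f0 g0 cfg; rewrite expr2.
have E (a b : I -> R) : (\sum_(i | P i) a i) * (\sum_(i | P i) b i)
    = \sum_(i | P i) \sum_(j | P j) a i * b j.
  by rewrite mulr_suml; apply: eq_bigr => i _; rewrite mulr_sumr.
(* The comparison is made pair by pair, by AM-GM: [(c i * c j) ^+ 2] is at most the product of the
   two terms on the right. *)
suff : \sum_(i | P i) \sum_(j | P j) (2 * (c i * c j)) <=
       \sum_(i | P i) \sum_(j | P j) (f i * g j + f j * g i).
  under eq_bigr do rewrite -mulr_sumr.
  under [X in _ <= X]eq_bigr do rewrite big_split.
  rewrite -mulr_sumr big_split /= -!E [X in _ <= _ + X]exchange_big /= -E.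
  by move=> h; lra.
apply: ler_sum => i Pi; apply: ler_sum => j Pj.
have fgij : 0 <= f i * g j by rewrite mulr_ge0 ?f0 ?g0.
have fgji : 0 <= f j * g i by rewrite mulr_ge0 ?f0 ?g0.
have hc : (c i * c j) ^+ 2 <= (f i * g j) * (f j * g i).
  by rewrite exprMn [leRHS](_ : _ = (f i * g i) * (f j * g j));
    [apply: ler_pM; rewrite ?sqr_ge0 ?cfg | ring].
rewrite (le_trans (ler_norm _)) // -(ler_pXn2r (n := 2)) ?nnegrE ?addr_ge0 //.
rewrite -normrX ger0_norm ?sqr_ge0 // exprMn.
have := sqr_ge0 (f i * g j - f j * g i); lra.
Qed.

Lemma sqr_sum_seq (R : realFieldType) (I : Type) (r : seq I) (a : I -> R) :
  (\sum_(i <- r) a i) ^+ 2 <= (size r)%:R * \sum_(i <- r) a i ^+ 2.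
Proof.
have E f : \sum_(i <- r) f i = \sum_(i < size r) f (tnth (in_tuple r) i) :> R.
  exact: big_tnth.
have -> : (size r)%:R = \sum_(i < size r) 1 :> R by rewrite sumr_const card_ord.
rewrite !E.
by apply: cauchy_sum => i _; rewrite ?mul1r ?sqr_ge0.
Qed.

(** * Mass, balls and energy of an embedding of the vertices *)

Section Embedding.
Variables (R : realFieldType) (J : finType).

Definition dotv (u v : J -> R) : R := \sum_j u j * v j.
Definition normv2 (u : J -> R) : R := \sum_j u j ^+ 2.

Lemma normv2_ge0 u : 0 <= normv2 u.
Proof. by apply: sumr_ge0 => j _; rewrite sqr_ge0. Qed.

Lemma normv2_eq0 u : normv2 u = 0 -> forall j, u j = 0.
Proof.
move/eqP; rewrite psumr_eq0 => [/allP h j|j _]; last exact: sqr_ge0.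
by have := h j (mem_index_enum _); rewrite sqrf_eq0 => /eqP.
Qed.

Lemma normv2B u v :
  normv2 (fun j => u j - v j) = normv2 u + normv2 v - 2 * dotv u v.
Proof.
rewrite /normv2 /dotv mulr_sumr -big_split -sumrB /=.
by apply: eq_bigr => j _; ring.
Qed.

Variables (V : finType) (e : rel V) (F : V -> J -> R) (s : bool).
Let deg x : R := #|[set y | e x y]|%:R.

(* For [s = true] this is the bipartite double cover of the graph; for
   [s = false], two disjoint copies of it. *)
Definition signed_cover : rel (V * bool) :=
  [rel p q | e p.1 q.1 && (q.2 == p.2 (+) s)].

(** The odd extension of [F] to both sheets: the sheet [true] carries [- F]. *)
Definition signed_lift (p : V * bool) (j : J) : R := (-1) ^+ p.2 * F p.1 j.

Definition mass x := deg x * normv2 (F x).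
Definition energy x y := normv2 (fun j => F x j - (-1) ^+ s * F y j).
(** Distance less than half of [|F x|], with both sides squared. *)
Definition near p x := 4 * normv2 (fun j => signed_lift p j - F x j) < normv2 (F x).
Definition ball x := [set y | near (y, false) x || near (y, true) x].
Definition ball_energy x := \sum_(y in ball x) \sum_(z | e y z) energy y z.

Lemma energy_ge0 x y : 0 <= energy x y. Proof. exact: normv2_ge0. Qed.

Lemma ball_energy_ge0 x : 0 <= ball_energy x.
Proof. by do 2![apply: sumr_ge0 => ? _]; exact: energy_ge0. Qed.

Lemma normv2_lift p : normv2 (signed_lift p) = normv2 (F p.1).
Proof. by apply: eq_bigr => j _; rewrite exprMn sqrr_sign mul1r. Qed.

Lemma energy_signed_cover p q : signed_cover p q ->
  normv2 (fun j => signed_lift p j - signed_lift q j) = energy p.1 q.1.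
Proof.
case/andP=> _ /eqP q2; apply: eq_bigr => j _.
rewrite /signed_lift q2 signr_addb -mulrA -mulrBr exprMn sqrr_sign mul1r //.
Qed.

Lemma dotv_lift p v : dotv (signed_lift p) v = (-1) ^+ p.2 * dotv (F p.1) v.
Proof. by rewrite mulr_sumr; apply: eq_bigr => j _; rewrite -mulrA. Qed.

Lemma near_ball p x : near p x -> p.1 \in ball x.
Proof. by rewrite inE; case: p => y [] -> //; rewrite orbT. Qed.

Lemma near_dotv p x : near p x ->
  3 * normv2 (F x) + 4 * normv2 (F p.1) < 8 * dotv (signed_lift p) (F x).
Proof. rewrite /near normv2B normv2_lift => h; lra. Qed.

(** Lifts of one vertex to the two sheets have opposite inner products with [F x], whereas being
    near forces a positive one. Hence a simple path of near points projects to distinct vertices of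
    the ball. *)
Lemma near_inj x : {in near^~ x &, injective fst}.
Proof.
move=> [y a] [z b] /near_dotv + /near_dotv + /= yz; rewrite -{}yz => /=.
have:= normv2_ge0 (F x); have:= normv2_ge0 (F y).
by case: a b => [] [] //=; rewrite !dotv_lift /= => *; exfalso; lra.
Qed.

Lemma ball_center x : 0 < normv2 (F x) -> x \in ball x.
Proof.
move=> h; rewrite inE /near [normv2 _]big1 ?mulr0 ?h // => j _.
by rewrite /signed_lift mul1r subrr expr0n.
Qed.

(** The angle between the lines of [F y] and [F x] is at most 30 degrees: squaring [near_dotv] and
    applying AM-GM bounds the squared cosine below by 3/4. *)
Lemma dotv_ball x y : y \in ball x ->
  0 < normv2 (F y) /\
  3 * (normv2 (F x) * normv2 (F y)) <= 4 * dotv (F y) (F x) ^+ 2.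
Proof.
move=> yB; have [p [<- px]] : exists p, p.1 = y /\ near p x.
  by move: yB; rewrite inE => /orP[] h; [exists (y, false)|exists (y, true)].
have := near_dotv px; have := normv2_ge0 (F x); have := normv2_ge0 (F p.1).
rewrite -[dotv (F p.1) _](signrMK p.2) -dotv_lift exprMn sqrr_sign mul1r.
set d := dotv (signed_lift p) (F x).
move=> y0 x0 h; split; last first.
  (* AM-GM: with [X], [Y] the squared norms, [(3 X + 4 Y)^2 >= 48 X Y], which is compared with
     [64 d^2]. *)
  have := sqr_ge0 (3 * normv2 (F x) - 4 * normv2 (F p.1)).
  have : (3 * normv2 (F x) + 4 * normv2 (F p.1)) ^+ 2 <= (8 * d) ^+ 2.
    by rewrite ler_pXn2r ?nnegrE //; lra.
  by move: (normv2 _) (normv2 _) => X Y; lra.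
rewrite lt_def y0 andbT; apply/eqP => /normv2_eq0 Fy0.
have d0 : d = 0.
  by rewrite /d dotv_lift /dotv big1 ?mulr0 // => j _; rewrite Fy0 mul0r.
by move: h; rewrite d0; lra.
Qed.

(* By Bessel's inequality, only little mass lies in a cone around [F y]. *)
Lemma mass_cover y :
    (forall v : J -> R, \sum_x deg x * dotv v (F x) ^+ 2 <= normv2 v) ->
  \sum_(x | y \in ball x) mass x <= 4 / 3.
Proof.
move=> bessel; have [x0 yx0|none] := pickP (fun x => y \in ball x); last first.
  by rewrite big_pred0 // divr_ge0.
have [Fy_gt0 _] := dotv_ball yx0.
have := bessel (F y); rewrite (bigID (fun x => y \in ball x)) /= => h.
rewrite ler_pdivlMr // -(ler_pM2r Fy_gt0) mulrAC !mulr_suml.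
apply: le_trans (_ : 4 * \sum_(x | y \in ball x) deg x * dotv (F y) (F x) ^+ 2 <= _).
  rewrite mulr_sumr; apply: ler_sum => x /dotv_ball[_ h1].
  rewrite [leLHS](_ : _ = deg x * (3 * (normv2 (F x) * normv2 (F y)))); last first.
    by rewrite /mass; ring.
  by rewrite [leRHS]mulrCA ler_wpM2l.
rewrite ler_wpM2l //; apply: le_trans h; rewrite lerDl sumr_ge0 // => x _.
by rewrite mulr_ge0 ?sqr_ge0.
Qed.

(** Double counting: after exchanging the sums, each [y] receives the mass of the centers whose
    balls contain it, which [mass_cover] bounds. *)
Lemma sum_mass_card_ball :
    (forall v : J -> R, \sum_x deg x * dotv v (F x) ^+ 2 <= normv2 v) ->
  \sum_x mass x * #|ball x|%:R <= 4 / 3 * #|V|%:R.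
Proof.
move=> bessel; under eq_bigr do rewrite -sum1_card natr_sum mulr_sumr.
under eq_bigr do under eq_bigr do rewrite mulr1.
rewrite (exchange_big_dep xpredT) //= -sum1_card natr_sum mulr_sumr.
by apply: ler_sum => y _; rewrite mulr1 mass_cover.
Qed.

Lemma sum_mass_ball_energy :
    (forall v : J -> R, \sum_x deg x * dotv v (F x) ^+ 2 <= normv2 v) ->
  \sum_x mass x * ball_energy x <= 4 / 3 * \sum_x \sum_(y | e x y) energy x y.
Proof.
move=> bessel; under eq_bigr do rewrite mulr_sumr.
rewrite (exchange_big_dep xpredT) //= mulr_sumr.
apply: ler_sum => y _; rewrite -mulr_suml ler_wpM2r ?mass_cover //.
by apply: sumr_ge0 => z _; exact: energy_ge0.
Qed.

(** In each coordinate the difference telescopes along the path, and Cauchy-Schwarz costs a factor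
    equal to the length. *)
Lemma normv2_path p l : path signed_cover p l ->
  normv2 (fun j => signed_lift p j - signed_lift (last p l) j) <=
    (size l)%:R * \sum_(q <- zip (p :: l) l) energy q.1.1 q.2.1.
Proof.
move=> pl; have -> : \sum_(q <- zip (p :: l) l) energy q.1.1 q.2.1 =
    \sum_j \sum_(q <- zip (p :: l) l) (signed_lift q.1 j - signed_lift q.2 j) ^+ 2.
  rewrite [RHS]exchange_big /=.
  elim: l p pl => [|q l IHl] p /=; first by rewrite !big_nil.
  by case/andP=> pq ql; rewrite !big_cons IHl //= -energy_signed_cover.
rewrite mulr_sumr ler_sum // => j _.
have -> : size l = size (zip (p :: l) l) by rewrite size_zip /= (minn_idPr _).
have -> : signed_lift p j - signed_lift (last p l) j =
    \sum_(q <- zip (p :: l) l) (signed_lift q.1 j - signed_lift q.2 j).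
  elim: l p {pl} => [|q l IHl] p /=; first by rewrite big_nil subrr.
  by rewrite big_cons -IHl /= addrA subrK.
exact: sqr_sum_seq.
Qed.

(** Every edge of the path starts at a near point, and by [near_inj] these starts project to
    distinct vertices of the ball. So there are at most [#|ball x|] edges, and they are distinct
    terms of [ball_energy x]; only the endpoint [q] may lie outside. *)
Lemma path_ball_energy x p l q :
    path signed_cover p (rcons l q) -> uniq (p :: l) -> all (near^~ x) (p :: l) ->
  normv2 (fun j => signed_lift p j - signed_lift q j) <= #|ball x|%:R * ball_energy x.
Proof.
move=> pq up nearp; have inB : {subset map fst (p :: l) <= ball x}.
  by move=> _ /mapP[r rp ->]; apply: near_ball; apply: (allP nearp).
have uB : uniq (map fst (p :: l)).
  rewrite map_inj_in_uniq // => r r' /(allP nearp) nr /(allP nearp) nr'.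
  exact: (near_inj nr nr').
have := normv2_path pq; rewrite last_rcons => /le_trans; apply.
apply: ler_pM => //; first by apply: sumr_ge0 => r _; exact: energy_ge0.
  rewrite ler_nat size_rcons -[_.+1]/(size (p :: l)) -(size_map fst) -(card_uniqP uB).
  exact/subset_leq_card/subsetP.
rewrite /ball_energy pair_big_dep /=.
set t := zip _ _; pose t' := [seq (r.1.1, r.2.1) | r <- t].
rewrite [leLHS](_ : _ = \sum_(r <- t') energy r.1 r.2); last by rewrite big_map.
have t1 : map fst t' = map fst (p :: l).
  rewrite -map_comp (eq_map (_ : _ =1 fst \o fst)) // map_comp; congr map.
  rewrite /t -(belast_rcons p l q) -/(unzip1 _).
  by elim: (rcons l q) p {t t' pq up nearp inB uB} => //= r l' IH p; rewrite IH.
have t'P : {subset t' <= [pred r | (r.1 \in ball x) && e r.1 r.2]}.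
  move=> r rt; apply/andP; split; first by rewrite inB // -t1; apply: map_f.
  have : all (fun r => e r.1 r.2) t'.
    rewrite all_map /t.
    elim: (rcons l q) p pq {t t' t1 rt up nearp inB uB} => //= r' l' IH p.
    by case/andP=> /andP[-> _] /IH ->.
  by move/allP/(_ r rt).
rewrite big_uniq /=; last by apply: (@map_uniq _ _ fst); rewrite t1.
rewrite [leRHS](bigID (mem t')) /= [X in X + _](eq_bigl (fun r => r \in t'));
  last first.
  move=> r; case: (boolP (r \in t')) => [/t'P h|_]; last by rewrite andbF.
  by rewrite andbT; exact: h.
by rewrite lerDl sumr_ge0 // => r _; exact: energy_ge0.
Qed.

(** A point with nonpositive inner product is not near, so a simple path to it has a first point
    that is not near. The path up to there moves [F] by at least [|F x| / 2]. *)
Lemma exists_exit x :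
    (exists2 p, connect signed_cover (x, false) p & dotv (signed_lift p) (F x) <= 0) ->
    0 < normv2 (F x) ->
  normv2 (F x) <= 4 * #|ball x|%:R * ball_energy x.
Proof.
case=> p /connectP[l pl ->] + Fx0; case/shortenP: pl => {}l pl ul _ lp.
have np : ~~ near (last (x, false) l) x.
  by apply/negP => /near_dotv; have := normv2_ge0 (F (last (x, false) l).1); lra.
have nx : near (x, false) x.
  rewrite /near [normv2 _]big1 ?mulr0 // => j _.
  by rewrite /signed_lift mul1r subrr expr0n.
have : has (fun p => ~~ near p x) l.
  apply/hasP; exists (last (x, false) l) => //.
  have := mem_last (x, false) l; rewrite inE => /orP[/eqP le|//].
  by rewrite le nx in np.
move=> h; case: (split_find h) pl ul => q l1 l2 nq hl1.
rewrite cat_path -cat_cons cat_uniq -rcons_cons rcons_uniq.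
case/andP=> pq _ /andP[/andP[_ ul] _].
have hl : all (near^~ x) ((x, false) :: l1).
  by move: hl1; rewrite /= nx has_predC negbK.
have h1 := path_ball_energy pq ul hl; rewrite -mulrA.
apply: le_trans (_ : 4 * normv2 (fun j => signed_lift q j - F x j) <= _).
  by rewrite leNgt.
rewrite ler_pM2l //; apply: le_trans h1.
by rewrite le_eqVlt; apply/orP; left; apply/eqP; apply: eq_bigr => j _;
  rewrite {2}/signed_lift mul1r -opprB sqrrN.
Qed.

(** A neighbour [z] outside the ball has neither lift near [x], in particular not the lift on sheet
    [s], which is the one [energy x z] compares with [F x]. Its edge thus has energy at least
    [normv2 (F x) / 4]. *)
Lemma energy_ge_far x : 0 < normv2 (F x) ->
  (#|[set y | e x y]|%:R - #|ball x|%:R) * normv2 (F x) <= 4 * ball_energy x.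
Proof.
move=> Fx0.
apply: le_trans (_ : 4 * \sum_(z | e x z) energy x z <= _); last first.
  rewrite ler_pM2l // /ball_energy [leRHS](bigD1 x) ?ball_center //= lerDl.
  by apply: sumr_ge0 => y _; apply: sumr_ge0 => z _; exact: energy_ge0.
apply: le_trans (_ : \sum_(z in [set y | e x y] :\: ball x) normv2 (F x) <= _).
  rewrite sumr_const -[leRHS]mulr_natl ler_wpM2r ?normv2_ge0 //.
  rewrite lerBlDr -natrD ler_nat -(cardsID (ball x) [set y | e x y]) addnC.
  by rewrite leq_add2l subset_leq_card ?subsetIr.
rewrite mulr_sumr.
rewrite [leRHS](bigID (fun z => z \in ball x)) /= addrC.
rewrite [X in _ <= X + _](eq_bigl (mem ([set y | e x y] :\: ball x))); last first.
  by move=> z; rewrite !inE andbC.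
apply: le_trans
  (_ : _ <= \sum_(z in [set y | e x y] :\: ball x) 4 * energy x z) _; last first.
  by rewrite lerDl sumr_ge0 // => z _; rewrite mulr_ge0 ?energy_ge0.
apply: ler_sum => z; rewrite !inE negb_or => /andP[/andP[n1 n2] _].
have : ~~ near (z, s) x by case: s n1 n2.
rewrite /near -leNgt => /le_trans; apply; rewrite ler_pM2l //.
rewrite /energy le_eqVlt; apply/orP; left; apply/eqP; apply: eq_bigr => j _.
by rewrite -opprB sqrrN.
Qed.

Lemma mass_le_ball_energy x :
    (exists2 p, connect signed_cover (x, false) p & dotv (signed_lift p) (F x) <= 0) ->
  mass x <= 8 * #|ball x|%:R ^+ 2 * ball_energy x.
Proof.
move=> ex; have [Fx0|] := ltP 0 (normv2 (F x)); last first.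
  move=> h; have /eqP h0 : normv2 (F x) == 0 by rewrite eq_le h normv2_ge0.
  by rewrite /mass h0 mulr0 mulr_ge0 ?ball_energy_ge0 // mulr_ge0 ?sqr_ge0.
have h1 := exists_exit ex Fx0; have h2 := energy_ge_far Fx0.
have b1 : 1 <= #|ball x|%:R :> R.
  by rewrite ler1n; apply/card_gt0P; exists x; exact: ball_center.
rewrite /mass /deg; move: h1 h2 b1.
move: #|ball x|%:R (ball_energy x) (normv2 _) Fx0 => b E r r0 h1 h2 b1.
have E0 : 0 <= E by nra.
(* If the degree is at most [2 b], the exit path decides; otherwise [d - b] exceeds [d / 2] and the
   far neighbours do, [1 <= b] absorbing the factor [b ^+ 2]. *)
have [dle|dlt] := lerP #|[set y | e x y]|%:R (2 * b).
  apply: le_trans (_ : 2 * b * r <= _); first by rewrite ler_pM2r.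
  have b2 : 0 <= 2 * b by lra.
  by have := ler_wpM2l b2 h1; lra.
move: dlt h2; move: #|[set y | e x y]|%:R => d dlt h2.
apply: le_trans (_ : 8 * E <= _); last first.
  rewrite ler_wpM2r // ler_peMr //; nra.
by have := ler_wpM2r (ltW r0) (ltW dlt); lra.
Qed.

(** Two applications of Cauchy-Schwarz: the first splits the mass as [mass x / b] against
    [mass x * b], with [b] the size of the ball; the second bounds the sum of [mass x / b] through
    [mass_le_ball_energy]. The covering bounds then handle the remaining sums. *)
Lemma embedding_bound (delta := \sum_x \sum_(y | e x y) energy x y) :
    (forall v : J -> R, \sum_x deg x * dotv v (F x) ^+ 2 <= normv2 v) ->
    (forall x, exists2 p, connect signed_cover (x, false) p &
                          dotv (signed_lift p) (F x) <= 0) ->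
  (\sum_x mass x) ^+ 4 <= 19 * delta * #|V|%:R ^+ 3.
Proof.
move=> bessel exit.
have mass0 x : 0 <= mass x by rewrite mulr_ge0 ?normv2_ge0.
have E0 := ball_energy_ge0.
have b0 x : 0 <= #|ball x|%:R :> R by [].
have h1 : (\sum_x mass x) ^+ 2 <=
    (\sum_x mass x / #|ball x|%:R) * (\sum_x mass x * #|ball x|%:R).
  apply: cauchy_sum => x _; [by rewrite divr_ge0 ?mass0|by rewrite mulr_ge0 ?mass0|].
  have := mass_le_ball_energy (exit x).
  (* For an empty ball the quotient is 0 by convention, and [mass_le_ball_energy] forces the mass to
     vanish too. *)
  have [->|bx] := eqVneq (#|ball x|%:R : R) 0.
    rewrite expr0n /= !(mulr0, mul0r) => h.
    have /eqP -> : mass x == 0 by rewrite eq_le h mass0.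
    by rewrite expr0n.
  by rewrite mulrACA mulVf // mulr1 expr2.
have h2 : (\sum_x mass x / #|ball x|%:R) ^+ 2 <=
    (\sum_x 8 * (mass x * ball_energy x)) * \sum_(x : V) 1.
  apply: cauchy_sum => x _; first by rewrite mulr_ge0 // mulr_ge0 ?mass0 ?E0.
    by [].
  rewrite mulr1.
  have := mass_le_ball_energy (exit x).
  have [->|bx] := eqVneq (#|ball x|%:R : R) 0.
    by rewrite invr0 mulr0 expr0n /= mulr_ge0 // mulr_ge0 ?mass0 ?E0.
  have bgt0 : 0 < #|ball x|%:R :> R by rewrite lt_def bx b0.
  move=> h; rewrite expr_div_n ler_pdivrMr ?exprn_gt0 //.
  apply: le_trans (ler_wpM2l (mass0 x) h) _.
  by rewrite le_eqVlt; apply/orP; left; apply/eqP; ring.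
move: h2; rewrite -mulr_sumr sumr_const => h2.
have h3 := sum_mass_card_ball bessel.
have h4 := sum_mass_ball_energy bessel.
have m0 : 0 <= \sum_x mass x * #|ball x|%:R.
  by apply: sumr_ge0 => x _; rewrite mulr_ge0 ?mass0 ?E0.
have mb0 : 0 <= \sum_x mass x / #|ball x|%:R.
  by apply: sumr_ge0 => x _; rewrite divr_ge0 ?mass0 ?E0.
have me0 : 0 <= \sum_x mass x * ball_energy x.
  by apply: sumr_ge0 => x _; rewrite mulr_ge0 ?mass0 ?E0.
have n0 : 0 <= #|V|%:R :> R by [].
have d0 : 0 <= delta.
  by apply: sumr_ge0 => y _; apply: sumr_ge0 => z _; exact: energy_ge0.
rewrite -/delta in h4; rewrite -[X in (\sum_x mass x) ^+ X]/(2 * 2)%N exprM.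
move: h1 h2 h3 h4 m0 mb0 me0 n0 d0.
move: (\sum_x mass x * ball_energy x) #|V|%:R delta => w n d.
move: (\sum_x mass x / #|ball x|%:R) (\sum_x mass x * #|ball x|%:R) => q p.
move: (\sum_x mass x) => u h1 h2 h3 h4 p0 q0 w0 n0 d0.
have p2 : p ^+ 2 <= (4 / 3 * n) ^+ 2 by rewrite ler_pXn2r ?nnegrE //; lra.
apply: le_trans (_ : (q * p) ^+ 2 <= _).
  by rewrite ler_pXn2r ?nnegrE ?sqr_ge0 ?mulr_ge0.
rewrite exprMn; apply: le_trans (_ : 8 * (4 / 3 * d) * n * (4 / 3 * n) ^+ 2 <= _).
  apply: ler_pM; rewrite ?sqr_ge0 //; apply: le_trans h2 _.
  by rewrite ler_wpM2r // ler_pM2l.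
(* The constant is [8 * (4/3) * (4/3)^2 = 512/27 < 19]. *)
have dn0 : 0 <= d * n ^+ 3 by rewrite mulr_ge0 ?exprn_ge0.
by rewrite [leLHS](_ : _ = 512 / 27 * (d * n ^+ 3)); [lra | field].
Qed.
End Embedding.

(** * Connectivity of the bipartite double cover *)

Section Cover.
Variables (V : finType) (e : rel V).
Hypotheses (e_sym : symmetric e) (e_conn : connected_graph e).

Lemma cover_sym s : symmetric (signed_cover e s).
Proof.
by move=> [x a] [y b]; rewrite /signed_cover /= e_sym; case: a b s => [] [] [].
Qed.

Lemma connect_cover_lift s x y a : exists b, connect (signed_cover e s) (x, a) (y, b).
Proof.
have /connectP[l xl ->] := e_conn x y; elim: l x a xl => [|z l IHl] x a /=.
  by exists a; exact: connect0.
case/andP=> xz /(IHl z (a (+) s))[b zb]; exists b; apply: connect_trans zb.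
by apply: connect1; rewrite /signed_cover /= xz eqxx.
Qed.

Lemma connect_cover_flip s p q : connect (signed_cover e s) p q ->
  connect (signed_cover e s) (p.1, ~~ p.2) (q.1, ~~ q.2).
Proof.
case/connectP=> l pl ->; elim: l p pl => [|r l IHl] p /=; first by rewrite connect0.
case/andP=> pr /IHl; apply: connect_trans; apply: connect1.
by case/andP: pr => pr /eqP r2; rewrite /signed_cover /= pr r2 addNb eqxx.
Qed.

Lemma connect_coverF x y : connect (signed_cover e false) (x, false) (y, false).
Proof.
have /connectP[l xl ->] := e_conn x y; elim: l x xl => [|z l IHl] x /=.
  by rewrite connect0.
case/andP=> xz /IHl; apply: connect_trans; apply: connect1.
by rewrite /signed_cover /= xz.
Qed.

(** If [(x, true)] were unreachable, no vertex could be reached on both sheets, since flipping the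
    sheets of one path and joining it to the other would reach [(x, true)]. The sheet on which a
    vertex is reached would then be a proper 2-colouring. *)
Lemma connect_cover_nonbipartite x : ~ bipartite e ->
  connect (signed_cover e true) (x, false) (x, true).
Proof.
move=> nonbip; apply/negP => /negP nxx; apply: nonbip.
have cs : connect_sym (signed_cover e true) := sym_connect_sym (cover_sym true).
have one y : ~~ (connect (signed_cover e true) (x, false) (y, false) &&
                 connect (signed_cover e true) (x, false) (y, true)).
  apply: contra nxx => /andP[h1 /connect_cover_flip /= h2].
  by apply: connect_trans h1 _; rewrite cs.
exists (fun y => connect (signed_cover e true) (x, false) (y, true)) => y z yz.
have st b : connect (signed_cover e true) (x, false) (y, b) ->
            connect (signed_cover e true) (x, false) (z, ~~ b).
  move=> h; apply: connect_trans h _; apply: connect1.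
  by rewrite /signed_cover /= yz addbT eqxx.
have [[] h] := connect_cover_lift true x y false.
  rewrite h; have := one z; rewrite (st _ h) /=.
  by case: (connect _ _ _).
have := one y; rewrite h /= => /negPf ->.
by rewrite (st _ h).
Qed.

End Cover.

(** * Orthonormal eigenbasis of the transition operator *)

Section Eigenbasis.
Variables (C : numClosedFieldType) (V : finType) (e : rel V).
Hypotheses (e_sym : symmetric e) (deg_gt0 : forall x, (0 < deg e x)%N).
Notation l2 := {ffun V -> C^o}.

(** The matrix [S] is [D^(1/2) P D^(-1/2)], real symmetric, hence unitarily diagonalisable. Dividing
    its eigenvectors by the square roots of the degrees gives eigenvectors of [P]; [U U^* = 1]
    yields orthonormality and [U^* U = 1] completeness. *)
Lemma exists_eigenbasis :
  exists (psi : 'I_#|V| -> l2) (lam : 'I_#|V| -> C),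
  [/\ forall i, lam i \is Num.real,
      forall i j, dotd e (psi i) (psi j) = (i == j)%:R,
      forall x y, \sum_i psi i x * (psi i y)^* * (deg e y)%:R = (x == y)%:R
    & forall i, transP C e (psi i) = lam i *: psi i].
Proof.
pose sd x : C := sqrtC (deg e x)%:R.
have sd0 x : sd x != 0 by rewrite sqrtC_eq0 pnatr_eq0 -lt0n.
have sdR x : sd x \is Num.real by rewrite ger0_real // sqrtC_ge0.
have sdr x : (sd x)^* = sd x by exact/CrealP.
have sd2 x : (deg e x)%:R = sd x * sd x by rewrite -expr2 sqrtCK.
pose S : 'M[C]_#|V| := \matrix_(a, b)
  ((e (enum_val a) (enum_val b))%:R / (sd (enum_val a) * sd (enum_val b))).
have Sh : S \is hermsymmx.
  apply: realsym_hermsym.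
    apply/is_hermitianmxP; rewrite expr0 scale1r map_mx_id //.
    by apply/matrixP => a b; rewrite !mxE e_sym [sd _ * _]mulrC.
  apply/mxOverP => a b; rewrite mxE.
  by rewrite rpred_div ?realM ?realn.
have Sn := hermitian_normalmx Sh.
pose U := spectralmx S; have Uu : U \is unitarymx := spectral_unitarymx S.
have US : U *m S = diag_mx (spectral_diag S) *m U.
  have /(congr1 (mulmx U)) := orthomx_spectralP Sn.
  by rewrite !mulmxA mulmxV ?mul1mx ?spectral_unit.
exists (fun i => [ffun x => U i (enum_rank x) / sd x]), (spectral_diag S 0).
split.
- by move=> i; have /mxOverP := hermitian_spectral_diag_real Sh; apply.
- move=> i j; have /unitarymxP/matrixP/(_ i j) := Uu; rewrite !mxE => <-.
  rewrite /dotd [RHS](reindex enum_rank) /=; last exact/onW_bij/enum_rank_bij.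
  apply: eq_bigr => x _; rewrite !ffunE !mxE rmorphM /= fmorphV /= sdr sd2.
  by move: (sd0 x); move: (sd x) => s s0; field.
- move=> x y; have := mulmx1C (unitarymxP Uu).
  move/matrixP/(_ (enum_rank y) (enum_rank x)); rewrite !mxE.
  rewrite (inj_eq enum_rank_inj) eq_sym => /(congr1 ( *%R^~ (sd y / sd x))) h.
  transitivity ((x == y)%:R * (sd y / sd x)); last first.
    by have [->|_] := eqVneq x y; rewrite ?mul0r ?divff ?mul1r.
  rewrite -h mulr_suml; apply: eq_bigr => i _.
  rewrite !ffunE !mxE rmorphM /= fmorphV /= sdr sd2.
  move: (sd0 x) (sd0 y); move: (sd x) (sd y) => s s' s0 s'0.
  by field; rewrite s0.
move=> i; apply/ffunP => x; rewrite lfunE !ffunE.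
have /matrixP/(_ i (enum_rank x)) := US.
rewrite mul_diag_mx !mxE /GRing.scale /= mulrA => <-.
rewrite (reindex enum_rank) /=; last exact/onW_bij/enum_rank_bij.
rewrite mulr_suml mulr_sumr [RHS](bigID (e x)) /= [X in _ + X]big1 ?addr0; last first.
  by move=> y /negPf xy; rewrite mxE !enum_rankK e_sym xy mul0r mulr0 mul0r.
apply: eq_bigr => y xy; rewrite ffunE mxE !enum_rankK e_sym xy sd2.
move: (sd0 x) (sd0 y); move: (sd x) (sd y) => s s' s0 s'0.
rewrite mulr1n; by field; rewrite s0 s'0.
Qed.
End Eigenbasis.

(** * Eigenvalues and spectral projections *)

Lemma char_poly_similar (F : fieldType) n (M A B : 'M[F]_n) :
  M \in unitmx -> M *m A = B *m M -> char_poly A = char_poly B.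
Proof.
move=> Mu MAB; pose Mp := map_mx (@polyC F) M.
have detM : \det Mp != 0.
  by rewrite det_map_mx /= polyC_eq0 -unitfE -unitmxE.
apply: (mulfI detM); rewrite [RHS]mulrC -!det_mulmx; congr (\det _).
rewrite /char_poly_mx mulmxBr mulmxBl -!map_mxM MAB; congr (_ - _).
by rewrite scalar_mxC.
Qed.

Section PermEigenvalues.
Import passmx.

(** The coordinate matrix of the independent family [psi] is invertible and conjugates [A] to a
    diagonal matrix, so both have the same characteristic polynomial; its roots are unique up to
    order. *)
Lemma perm_eigenvalues (C : numClosedFieldType) (vT : vectType C)
    (A : 'End(vT)) n (psi : 'I_n -> vT) (a : 'I_n -> C) :
    \dim {:vT} = n ->
    (forall k : 'I_n -> C, \sum_i k i *: psi i = 0 -> forall i, k i = 0) ->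
    (forall i, A (psi i) = a i *: psi i) ->
  perm_eq (eigenvalues A) [seq a i | i <- enum 'I_n].
Proof.
move=> dimn; case: _ / dimn psi a => psi a free_psi A_psi.
rewrite /eigenvalues perm_sort.
set b := vbasis _; have bb : basis_of {:vT} b := vbasisP _.
pose M := \matrix_i rVof b (psi i).
have Mrow (u : 'rV_(\dim {:vT})) :
    u *m M = rVof b (\sum_i u 0 i *: psi i).
  rewrite mulmx_sum_row linear_sum; apply: eq_bigr => i _.
  by rewrite linearZ rowK.
have Mu : M \in unitmx.
  rewrite -row_free_unit -kermx_eq0; apply/eqP/row_matrixP => i.
  have /(congr1 (row i)) := mulmx_ker M; rewrite row_mul Mrow !row0.
  move/eqP; rewrite rVof_eq0 // => /eqP h.
  by apply/rowP => j; have := free_psi _ h j; rewrite !mxE.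
have MA : M *m mxof b b A = diag_mx (\row_i a i) *m M.
  apply/row_matrixP => i; rewrite !row_mul rowK row_diag_mx -scalemxAl -rowE rowK.
  by rewrite -rVof_app // A_psi linearZ mxE.
case: closed_field_poly_normal => s /=.
rewrite (char_poly_similar Mu MA).
rewrite (monicP (char_poly_monic _)) scale1r char_poly_trig ?diag_mx_is_trig // => h.
apply: prod_XsubC_eq; rewrite -h big_map big_enum /=.
by apply: eq_bigr => i _; rewrite !mxE eqxx.
Qed.
End PermEigenvalues.

Section SpectralProjection.
Variables (C : numClosedFieldType) (V : finType) (e : rel V).
Notation l2 := {ffun V -> C^o}.
Implicit Types f g : l2.

Lemma dotdC f g : dotd e f g = (dotd e g f)^*.
Proof.
rewrite /dotd rmorph_sum; apply: eq_bigr => x _.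
by rewrite !rmorphM /= conjCK conjC_nat; ring.
Qed.

Lemma dotdZl a f g : dotd e (a *: f) g = a * dotd e f g.
Proof. by rewrite -!/(dotdr e g _) linearZ. Qed.

Lemma dotd_suml I (r : seq I) (P : pred I) (f : I -> l2) g :
  dotd e (\sum_(i <- r | P i) f i) g = \sum_(i <- r | P i) dotd e (f i) g.
Proof. by rewrite -/(dotdr e g _) linear_sum. Qed.

Lemma dotdZr a f g : dotd e f (a *: g) = a^* * dotd e f g.
Proof. by rewrite dotdC dotdZl rmorphM /= -dotdC. Qed.

Lemma dotd_sumr I (r : seq I) (P : pred I) f (g : I -> l2) :
  dotd e f (\sum_(i <- r | P i) g i) = \sum_(i <- r | P i) dotd e f (g i).
Proof.
by rewrite dotdC dotd_suml rmorph_sum; apply: eq_bigr => i _; rewrite [RHS]dotdC.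
Qed.

Lemma mem_orthod (U : {vspace l2}) f :
  reflect {in U, forall g, dotd e f g = 0} (f \in orthod e U).
Proof.
have -> : (f \in orthod e U) = all (fun g => dotd e f g == 0) (vbasis U).
  rewrite /orthod; elim: (tval (vbasis U)) => [|g s IHs].
    by rewrite big_nil memvf.
  by rewrite big_cons memv_cap IHs memv_ker lfunE.
apply: (iffP allP) => [fU g gU|fU g /vbasis_mem gU]; last by rewrite fU.
rewrite (coord_vbasis gU) dotd_sumr big1 // => i _.
by rewrite dotdZr (eqP (fU _ _)) ?mulr0 // mem_nth ?size_tuple.
Qed.

Variables (psi : 'I_#|V| -> l2).
Hypothesis psi_orth : forall i j, dotd e (psi i) (psi j) = (i == j)%:R.
Hypothesis psi_complete : forall x y,
  \sum_i psi i x * (psi i y)^* * (deg e y)%:R = (x == y)%:R.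

Lemma dotd_sum_psi (P : pred 'I_#|V|) (k : 'I_#|V| -> C) j :
  dotd e (\sum_(i | P i) k i *: psi i) (psi j) = if P j then k j else 0.
Proof.
rewrite dotd_suml; case: ifP => Pj; last first.
  rewrite big1 // => i Pi; rewrite dotdZl psi_orth.
  by case: eqP Pi Pj => [->->|_ _ _] //; rewrite mulr0.
rewrite (bigD1 j) //= dotdZl psi_orth eqxx mulr1 big1 ?addr0 // => i /andP[_ /negPf ij].
by rewrite dotdZl psi_orth ij mulr0.
Qed.

Lemma psi_expand f : f = \sum_i dotd e f (psi i) *: psi i.
Proof.
apply/ffunP => y; rewrite sum_ffunE.
under eq_bigr do rewrite ffunE /GRing.scale /= /dotd mulr_suml.
rewrite exchange_big /= (bigD1 y) //=.
have E x : \sum_i (deg e x)%:R * f x * (psi i x)^* * psi i y = f x * (y == x)%:R.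
  rewrite -psi_complete mulr_sumr; apply: eq_bigr => i _; ring.
rewrite E eqxx mulr1 big1 ?addr0 // => x /negPf xy.
by rewrite E eq_sym xy mulr0.
Qed.

Variables (A : 'End(l2)) (a : 'I_#|V| -> C).
Hypothesis A_psi : forall i, A (psi i) = a i *: psi i.

Lemma perm_eigenvalues_basis : perm_eq (eigenvalues A) [seq a i | i <- enum 'I_#|V|].
Proof.
apply: perm_eigenvalues A_psi.
  by rewrite dimvf /dim /= muln1.
move=> k k0 i; have := dotd_sum_psi xpredT k i.
by rewrite k0 -/(dotdr e _ _) linear0.
Qed.

Variable B : pred C.
Let U := eigenspan A B.

Lemma psi_eigenspan i : B (a i) -> psi i \in U.
Proof.
move=> Bi; rewrite /U /eigenspan (big_rem (a i)) ?Bi /=; last first.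
  by rewrite (perm_mem perm_eigenvalues_basis) map_f ?mem_enum.
apply: (subvP (addvSl _ _)); rewrite memv_ker.
by rewrite !lfun_simp A_psi subrr.
Qed.

(** If [A g = z g], comparing coefficients along [psi j] gives [(z - a j) * dotd e g (psi j) = 0],
    and [z] differs from [a j] because only [z] satisfies [B]. *)
Lemma eigenspan_psi f j : f \in U -> ~~ B (a j) -> dotd e f (psi j) = 0.
Proof.
move=> fU Bj; suff /subvP/(_ f fU) : (U <= lker (linfun (dotdr e (psi j))))%VS.
  by rewrite memv_ker lfunE /= => /eqP.
rewrite /U /eigenspan.
apply: (big_ind (fun W => W <= _)%VS) => [|W W' sW sW'|z Bz].
- exact: sub0v.
- by rewrite subv_add sW.
apply/subvP => g; rewrite !memv_ker !lfun_simp /= subr_eq0 => /eqP Ag.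
have : dotd e (A g) (psi j) = a j * dotd e g (psi j).
  rewrite [in LHS](psi_expand g) linear_sum.
  under eq_bigr do rewrite linearZ /= A_psi scalerA.
  by rewrite dotd_sum_psi mulrC.
rewrite Ag dotdZl => /eqP; rewrite -subr_eq0 -mulrBl mulf_eq0 subr_eq0.
by case/predU1P => // za; rewrite -za Bz in Bj.
Qed.

Lemma spectral_projE f :
  spectral_proj e A B f = \sum_(i | B (a i)) dotd e f (psi i) *: psi i.
Proof.
(* [daddv_pi] acts as the projection along the second space only when the two spaces meet
   trivially. *)
have cap0 : (U :&: orthod e U = 0)%VS.
  apply/eqP; rewrite -subv0; apply/subvP => g; rewrite memv_cap memv0.
  case/andP=> gU /mem_orthod gO; rewrite (psi_expand g) big1 // => i _.
  by case: (boolP (B (a i))) => Bi;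
    [rewrite gO ?psi_eigenspan | rewrite eigenspan_psi]; rewrite ?scale0r.
rewrite [in LHS](psi_expand f) (bigID (fun i => B (a i))) /= linearD /=.
rewrite /spectral_proj -/U daddv_pi_id //; last first.
  by apply: memv_suml => i Bi; rewrite memvZ ?psi_eigenspan.
set g := \sum_(i | ~~ _) _.
have gO : g \in orthod e U.
  apply/mem_orthod => h hU; rewrite dotd_suml big1 // => i Bi.
  by rewrite dotdZl [dotd e (psi i) h]dotdC (eigenspan_psi hU Bi) conjC0 mulr0.
have gUO : g \in (U + orthod e U)%VS by apply: (subvP (addvSr _ _)).
have cap0' : (orthod e U :&: U = 0)%VS by rewrite capvC.
have h2 := daddv_pi_add cap0 gUO; rewrite (daddv_pi_id cap0' gO) in h2.
have {}h2 : daddv_pi U (orthod e U) g = 0 by rewrite -[LHS](addrK g) h2 subrr.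
by rewrite h2 addr0.
Qed.

End SpectralProjection.

Section SpectralMeasure.
Variables (C : numClosedFieldType) (V : finType) (e : rel V).
Notation l2 := {ffun V -> C^o}.
Hypothesis deg_gt0 : forall x, (0 < deg e x)%N.
Variables (psi : 'I_#|V| -> l2) (lam : 'I_#|V| -> C).
Hypothesis psi_orth : forall i j, dotd e (psi i) (psi j) = (i == j)%:R.
Hypothesis psi_complete : forall x y,
  \sum_i psi i x * (psi i y)^* * (deg e y)%:R = (x == y)%:R.
Hypothesis P_psi : forall i, transP C e (psi i) = lam i *: psi i.

Lemma opQ_psi i : opQ C e (psi i) = (1 + lam i) *: psi i.
Proof. by rewrite /opQ add_lfunE id_lfunE P_psi scalerDl scale1r. Qed.

(** Summed over [x], the diagonal contribution of each [psi i] in the window is its squared norm 1,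
    so the average measure counts eigenvalues. *)
Lemma muQE delta :
  muQ e delta = #|[set i | 0 <= 1 + lam i <= delta]|%:R / #|V|%:R.
Proof.
rewrite /muQ mulrC; congr (_ / _).
have e_psi x i : dotd e (unit_at C e x) (psi i) = sqrtC (deg e x)%:R * (psi i x)^*.
  rewrite /dotd (bigD1 x) //= big1 ?addr0 => [|y /negPf yx]; last first.
    by rewrite ffunE yx mul0r mulr0 mul0r.
  rewrite ffunE eqxx -{1}(sqrtCK (deg e x)%:R).
  have : sqrtC (deg e x)%:R != 0 :> C by rewrite sqrtC_eq0 pnatr_eq0 -lt0n.
  rewrite mulr1n; move: (sqrtC _) => s s0; by field.
have muQ_atE x : muQ_at e x delta =
    \sum_(i | 0 <= 1 + lam i <= delta) (deg e x)%:R * psi i x * (psi i x)^*.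
  rewrite /muQ_at (spectral_projE psi_orth psi_complete opQ_psi) dotd_suml.
  apply: eq_bigr => i _; rewrite dotdZl [dotd e (psi i) _]dotdC e_psi.
  rewrite -[in RHS](sqrtCK (deg e x)%:R) rmorphM /= conjCK.
  rewrite (_ : (sqrtC _)^* = sqrtC (deg e x)%:R); first by ring.
  by apply/CrealP/ger0_real; rewrite sqrtC_ge0.
under eq_bigr do rewrite muQ_atE.
rewrite exchange_big /= -sum1dep_card natr_sum.
by apply: eq_big => [i|i _]; rewrite ?inE // -/(dotd e _ _) psi_orth eqxx.
Qed.
End SpectralMeasure.

(** * Dirichlet forms of [1 - P] and [1 + P] *)

Section Dirichlet.
Variables (C : numClosedFieldType) (V : finType) (e : rel V).
Notation l2 := {ffun V -> C^o}.
Hypotheses (e_sym : symmetric e) (deg_gt0 : forall x, (0 < deg e x)%N).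
Implicit Types f g : l2.

Lemma degM_transP f x : (deg e x)%:R * transP C e f x = \sum_(y | e x y) f y.
Proof. by rewrite lfunE ffunE mulrA divff ?mul1r // pnatr_eq0 -lt0n. Qed.

Lemma sum_neighbours (h : V -> C) :
  \sum_x \sum_(y | e x y) h y = \sum_x (deg e x)%:R * h x.
Proof.
rewrite (exchange_big_dep xpredT) //=; apply: eq_bigr => x _.
rewrite sumr_const mulr_natl; congr (_ *+ _); rewrite /deg -cardsE.
by apply: eq_card => y; rewrite !inE e_sym.
Qed.

Lemma dotd_transP f g : dotd e (transP C e f) g = \sum_x \sum_(y | e x y) f y * (g x)^*.
Proof.
by rewrite /dotd; apply: eq_bigr => x _; rewrite degM_transP mulr_suml.
Qed.

Lemma dirichlet_form (s : bool) f :
  \sum_x \sum_(y | e x y) (f x - (-1) ^+ s * f y) * (f x - (-1) ^+ s * f y)^* =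
  2 * dotd e f f
    - (-1) ^+ s * (dotd e (transP C e f) f + (dotd e (transP C e f) f)^*).
Proof.
have sg : ((-1) ^+ s)^* = (-1) ^+ s :> C by rewrite rmorphXn rmorphN1.
have -> : 2 * dotd e f f = \sum_x \sum_(y | e x y) (f x * (f x)^*)
                          + \sum_x \sum_(y | e x y) (f y * (f y)^*).
  rewrite (sum_neighbours (fun y => f y * (f y)^*)) mulr_natl mulr2n.
  congr (_ + _); last by apply: eq_bigr => x _; rewrite mulrA.
  apply: eq_bigr => x _; rewrite sumr_const -mulrA mulr_natl; congr (_ *+ _).
  by rewrite /deg cardsE.
rewrite dotd_transP rmorph_sum /=.
under [X in - (_ * (_ + X))]eq_bigr do rewrite rmorph_sum /=.
rewrite mulrDr !mulr_sumr -!big_split -sumrB /=; apply: eq_bigr => x _.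
rewrite !mulr_sumr -!big_split -sumrB /=; apply: eq_bigr => y _.
rewrite rmorphB !rmorphM /= sg conjCK.
have s2 : (-1) ^+ s * (-1) ^+ s = 1 :> C by rewrite -expr2 sqrr_sign.
have := s2; move: ((-1) ^+ s) => b {}s2.
(* The squared sign is inserted so that the identity becomes polynomial in [b]. *)
rewrite (_ : f y * (f y)^* = b * b * (f y * (f y)^*)); last by rewrite s2 mul1r.
ring.
Qed.

Lemma dotd_transP1 f : dotd e (transP C e f) [ffun _ => 1] = dotd e f [ffun _ => 1].
Proof.
rewrite dotd_transP (eq_bigr (fun x => \sum_(y | e x y) f y)); last first.
  by move=> x _; apply: eq_bigr => y _; rewrite ffunE conjC1 mulr1.
by rewrite sum_neighbours; apply: eq_bigr => x _; rewrite ffunE conjC1 mulr1.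
Qed.

End Dirichlet.

(** * Summation over spectral gaps *)

Section GapSum.
Variable R : realFieldType.

Lemma bernoulli t (x : R) : 0 <= x -> 1 + t%:R * x <= (1 + x) ^+ t.
Proof.
move=> x0; elim: t => [|k IHk]; first by rewrite expr0 mul0r addr0.
rewrite exprS; apply: le_trans (_ : (1 + x) * (1 + k%:R * x) <= _).
  have : 0 <= k%:R * x * x by rewrite !mulr_ge0.
  by rewrite -natr1; lra.
by rewrite ler_wpM2l //; lra.
Qed.

(** Bernoulli replaces [1 + t x] by [(1 + x)^t], and [(1 - x^2)^t <= 1]. *)
Lemma expr_gap_le t (x : R) : 0 <= x <= 1 -> (1 - x) ^+ t * (1 + t%:R * x) <= 1.
Proof.
case/andP=> x0 x1; apply: le_trans (_ : (1 - x) ^+ t * (1 + x) ^+ t <= _).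
  by rewrite ler_wpM2l ?bernoulli // exprn_ge0 // subr_ge0.
rewrite -exprMn exprn_ile1 //; first by rewrite mulr_ge0 //; lra.
by have := mulr_ge0 x0 x0; lra.
Qed.

(** Combined with a counting bound [x^3 <= 38 T N^3], this reads [(4 N + x)^2 <= 60 N^2 (1 + T)], as
    [gap_step] requires. *)
Lemma gap_poly (N x : R) : 0 < N -> 0 <= x ->
  N * (4 * N + x) ^+ 2 <= 60 * N ^+ 3 + 60 / 38 * x ^+ 3.
Proof.
move=> N_gt0 x0; have N0 := ltW N_gt0.
have h1 : 0 <= N * (x - 3 * N) ^+ 2 by rewrite mulr_ge0 ?sqr_ge0.
have h2 : 0 <= x * (x - 3 * N) ^+ 2 by rewrite mulr_ge0 ?sqr_ge0.
have h3 : 0 <= N ^+ 3 by rewrite exprn_ge0.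
have h4 : 0 <= N ^+ 2 * x by rewrite mulr_ge0 ?sqr_ge0.
have h5 : 0 <= N * x ^+ 2 by rewrite mulr_ge0 ?sqr_ge0.
nra.
Qed.

(** The right-hand side is [60 N^2] over a product of consecutive denominators, which is at most
    [(4 N + x + 1)^2], hence at most [60 N^2 (1 + T)] by [gap_poly]. *)
Lemma gap_step (N w T x : R) :
    0 < N -> 0 <= w -> w * (1 + T) <= 1 -> 0 <= x -> 0 <= T ->
    (x + 1) ^+ 3 <= 38 * T * N ^+ 3 ->
  w <= 60 * N ^+ 2 / (4 * N + x) - 60 * N ^+ 2 / (4 * N + (x + 1)).
Proof.
move=> N_gt0 w0 wT x0 T0 hT.
have p1 : 0 < 4 * N + x by lra.
have p2 : 0 < 4 * N + (x + 1) by lra.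
rewrite [leRHS](_ : _ = 60 * N ^+ 2 / ((4 * N + x) * (4 * N + (x + 1)))); last first.
  by field; rewrite !gt_eqF.
rewrite ler_pdivlMr; last by rewrite mulr_gt0 //; lra.
have key : (4 * N + (x + 1)) ^+ 2 <= 60 * N ^+ 2 * (1 + T).
  rewrite -(ler_pM2l N_gt0).
  have : N * (4 * N + (x + 1)) ^+ 2 <= 60 * N ^+ 3 + 60 / 38 * (x + 1) ^+ 3.
    have : 0 <= x + 1 by lra.
    exact: gap_poly.
  by lra.
apply: le_trans (_ : w * (4 * N + (x + 1)) ^+ 2 <= _).
  by rewrite ler_wpM2l // expr2 ler_wpM2r; lra.
have := ler_wpM2l w0 key; have : 0 <= 60 * N ^+ 2 by rewrite mulr_ge0 ?sqr_ge0.
by move=> N2 h; have := ler_wpM2l N2 wT; lra.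
Qed.

(* Removing an element of largest gap from a set of [m] elements decreases the
   bound by [60 N^2 / ((4 N + m) (4 N + m - 1))]. *)
Lemma sum_gap_le (I : finType) (g : I -> R) (t : nat) (N : R) (S : {set I}) :
    0 < N ->
    (forall i, i \in S -> 0 <= g i <= 1) ->
    (forall i, i \in S ->
       #|[set j in S | g j <= g i]|%:R ^+ 3 <= 38 * g i * (N ^+ 3 * t%:R)) ->
  \sum_(i in S) (1 - g i) ^+ t <= 15 * N - 60 * N ^+ 2 / (4 * N + #|S|%:R).
Proof.
move=> N_gt0; move: {2}#|S| (erefl #|S|) => m; elim: m S => [|m IHm] S Sm g01 gS.
  move/eqP: Sm; rewrite cards_eq0 => /eqP ->; rewrite big_set0 cards0 addr0.
  rewrite (_ : 60 * N ^+ 2 / (4 * N) = 15 * N) ?subrr //.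
  by field; rewrite gt_eqF.
have [i0 i0S] : exists i, i \in S by apply/card_gt0P; rewrite Sm.
have [i iS' imax] := arg_maxP g i0S; have iS : i \in S := iS'.
(* As [i] has the largest gap, its counting hypothesis bounds the size of all of [S]. *)
have SE : [set j in S | g j <= g i] = S.
  apply/setP => j; rewrite inE; case: (boolP (j \in S)) => //= /imax.
  by apply.
have := gS i iS; rewrite SE => h.
have Sim : #|S :\ i| = m by move: Sm; rewrite (cardsD1 i) iS => -[].
have {}IHm : \sum_(j in S :\ i) (1 - g j) ^+ t <= 15 * N - 60 * N ^+ 2 / (4 * N + m%:R).
  rewrite -[in m%:R]Sim; apply: IHm => // [j|j].
    by rewrite inE => /andP[_ /g01].
  rewrite inE => /andP[_ jS]; apply: le_trans (gS j jS).
  by rewrite ler_pXn2r ?nnegrE // ler_nat subset_leq_card //; apply/subsetP => k;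
    rewrite !inE -andbA => /and3P[_ -> ->].
rewrite (big_setD1 i) //= Sm.
suff : (1 - g i) ^+ t <= 60 * N ^+ 2 / (4 * N + m%:R) - 60 * N ^+ 2 / (4 * N + m.+1%:R).
  by move=> h'; lra.
have wT := expr_gap_le t (g01 i iS); have /andP[gi0 gi1] := g01 i iS.
have w0 : 0 <= (1 - g i) ^+ t by rewrite exprn_ge0 // subr_ge0.
have m0 : 0 <= m%:R :> R by [].
have T0 : 0 <= t%:R * g i by rewrite mulr_ge0.
have {h gi0 gi1}hT : (m%:R + 1) ^+ 3 <= 38 * (t%:R * g i) * N ^+ 3.
  move: h; rewrite Sm -[m.+1%:R]natr1 => /le_trans; apply.
  by rewrite le_eqVlt; apply/orP; left; apply/eqP; ring.
rewrite -[m.+1%:R]natr1; exact: gap_step hT.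
Qed.
End GapSum.

(** * Counting eigenvalues *)

Local Open Scope complex_scope.

Section EigenbasisCounting.
Variables (R : rcfType) (V : finType) (e : rel V).
Local Notation C := R[i].
Local Notation l2 := {ffun V -> C^o}.

Definition sqmod (z : C) : R := complex.Re z ^+ 2 + complex.Im z ^+ 2.

Lemma mulcJ (z : C) : z * Num.conj z = (sqmod z)%:C.
Proof. by rewrite -normCK add_Re2_Im2. Qed.

Lemma sqmod_ge0 z : 0 <= sqmod z.
Proof. by rewrite addr_ge0 ?sqr_ge0. Qed.

Hypotheses (e_sym : symmetric e) (e_conn : connected_graph e).
Hypothesis deg_gt0 : forall x, (0 < deg e x)%N.
Variables (psi : 'I_#|V| -> l2) (lam : 'I_#|V| -> R).
Hypothesis psi_orth : forall i j, dotd e (psi i) (psi j) = (i == j)%:R.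
Hypothesis psi_complete : forall x y,
  \sum_i psi i x * Num.conj (psi i y) * (deg e y)%:R = (x == y)%:R.
Hypothesis P_psi : forall i, transP C e (psi i) = (lam i)%:C *: psi i.

Lemma dirichlet_psi (s : bool) i :
  \sum_x \sum_(y | e x y) sqmod (psi i x - (-1) ^+ s * psi i y) =
  2 * (1 - (-1) ^+ s * lam i).
Proof.
apply: complexI; rewrite rmorph_sum /=.
under eq_bigr do rewrite rmorph_sum /=.
under eq_bigr do under eq_bigr do rewrite -mulcJ.
rewrite (dirichlet_form e_sym deg_gt0) P_psi dotdZl psi_orth eqxx /= mulr1n !mulr1.
rewrite (_ : Num.conj (lam i)%:C = (lam i)%:C); last exact: conjc_real.
by rewrite !rmorphM rmorphB rmorphM rmorphXn /= rmorphN1 rmorph1 rmorph_nat; ring.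
Qed.

Lemma lam_bound (s : bool) i : 0 <= 1 - (-1) ^+ s * lam i.
Proof.
rewrite -(pmulr_rge0 _ (ltr0Sn R 1)) -dirichlet_psi.
by apply: sumr_ge0 => x _; apply: sumr_ge0 => y _; exact: sqmod_ge0.
Qed.

(* The coordinates of the spectral embedding of [S], each complex coordinate
   being split into its real and imaginary parts. *)
Definition embed (S : {set 'I_#|V|}) (x : V) (j : 'I_#|V| * bool) : R :=
  if j.1 \in S then
    if j.2 then complex.Im (psi j.1 x) else complex.Re (psi j.1 x)
  else 0.

Lemma sum_pair_bool (h : 'I_#|V| * bool -> R) :
  \sum_j h j = \sum_i (h (i, false) + h (i, true)).
Proof.
rewrite (eq_bigr (fun j => h (j.1, j.2))) => [|[] //].
rewrite -(pair_bigA _ (fun i b => h (i, b))) /=; apply: eq_bigr => i _.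
by rewrite big_bool addrC.
Qed.

Lemma normv2_embed S x : normv2 (embed S x) = \sum_(i in S) sqmod (psi i x).
Proof.
rewrite /normv2 sum_pair_bool [RHS]big_mkcond; apply: eq_bigr => i _ /=.
by rewrite /embed /=; case: ifP => // _; rewrite expr0n /= addr0.
Qed.

Lemma energy_embed S (s : bool) x y : energy (embed S) s x y =
  \sum_(i in S) sqmod (psi i x - (-1) ^+ s * psi i y).
Proof.
rewrite /energy /normv2 sum_pair_bool [RHS]big_mkcond; apply: eq_bigr => i _ /=.
rewrite /embed /=; case: ifP => _; last by rewrite mulr0 subr0 expr0n /= addr0.
rewrite /sqmod; case: s; rewrite ?(expr1, expr0, mulN1r, mul1r);
  by case: (psi i x) (psi i y) => a b [c d].
Qed.

Lemma sum_mass_embed S : \sum_x mass e (embed S) x = #|S|%:R.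
Proof.
under eq_bigr do rewrite /mass normv2_embed mulr_sumr.
rewrite exchange_big -sum1_card natr_sum; apply: eq_bigr => i _.
apply: complexI; rewrite rmorph_sum.
transitivity (dotd e (psi i) (psi i)); last by rewrite psi_orth eqxx rmorph1.
by apply: eq_bigr => x _ /=; rewrite rmorphM rmorph_nat /= -mulcJ mulrA.
Qed.

Lemma sum_energy_embed S (s : bool) :
  \sum_x \sum_(y | e x y) energy (embed S) s x y =
  2 * \sum_(i in S) (1 - (-1) ^+ s * lam i).
Proof.
under eq_bigr do under eq_bigr do rewrite energy_embed.
under eq_bigr do rewrite exchange_big.
rewrite exchange_big mulr_sumr; apply: eq_bigr => i _; exact: dirichlet_psi.
Qed.

Lemma bessel_embed S (v : 'I_#|V| * bool -> R) :
  \sum_x (deg e x)%:R * dotv v (embed S x) ^+ 2 <= normv2 v.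
Proof.
(* These complex coefficients make [dotv v (embed S x)] the real part of [g x]; Parseval for [g]
   then gives Bessel's inequality. *)
pose w i : C := v (i, false) -i* v (i, true).
pose g : l2 := \sum_(i in S) w i *: psi i.
have dotvE x : dotv v (embed S x) = complex.Re (g x).
  rewrite /dotv sum_pair_bool /g sum_ffunE raddf_sum [RHS]big_mkcond.
  apply: eq_bigr => i _; rewrite /embed /=.
  case: ifP => _; last by rewrite !mulr0 addr0.
  by rewrite ffunE /GRing.scale /=; case: (psi i x) => a b /=; ring.
apply: le_trans (_ : \sum_x (deg e x)%:R * sqmod (g x) <= _).
  by apply: ler_sum => x _; rewrite ler_wpM2l // dotvE lerDl sqr_ge0.
rewrite (_ : \sum_x _ = \sum_(i in S) sqmod (w i)).
  rewrite /normv2 sum_pair_bool [leLHS]big_mkcond; apply: ler_sum => i _.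
  case: ifP => _; last by rewrite addr_ge0 ?sqr_ge0.
  by rewrite /sqmod /= sqrrN.
apply: complexI; rewrite !rmorph_sum /=.
transitivity (dotd e g g).
  by apply: eq_bigr => x _; rewrite rmorphM rmorph_nat /= -mulcJ mulrA.
rewrite {2}/g dotd_sumr; apply: eq_bigr => i iS.
by rewrite dotdZr (dotd_sum_psi psi_orth) iS -mulcJ mulrC.
Qed.

(** With mass [k] and energy at most [2 k delta], [embedding_bound] reads [k^4 <= 38 k delta n^3];
    one factor [k] cancels. *)
Lemma card_embed_bound (S : {set 'I_#|V|}) (s : bool) (delta : R) : 0 <= delta ->
    (forall i, i \in S -> 1 - (-1) ^+ s * lam i <= delta) ->
    (forall x, exists2 p, connect (signed_cover e s) (x, false) p &
                          dotv (signed_lift (embed S) p) (embed S x) <= 0) ->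
  #|S|%:R ^+ 3 <= 38 * delta * #|V|%:R ^+ 3.
Proof.
move=> delta0 Sdelta exit.
have := embedding_bound (@bessel_embed S) exit.
rewrite sum_mass_embed sum_energy_embed => h.
have : \sum_(i in S) (1 - (-1) ^+ s * lam i) <= \sum_(i in S) delta.
  exact: ler_sum.
rewrite sumr_const -[in leRHS]mulr_natl => h2.
have [S0|] := eqVneq #|S| 0%N.
  by rewrite S0 expr0n /= !mulr_ge0 ?exprn_ge0.
rewrite -lt0n -(ltr0n R) => S0; rewrite -(ler_pM2l S0).
move: h h2 S0; move: (\sum_(i in S) _) #|S|%:R => E k h h2 k0.
rewrite -exprS; apply: le_trans h _.
rewrite [leRHS](_ : _ = 19 * (2 * (k * delta)) * #|V|%:R ^+ 3); last by ring.
by rewrite ler_wpM2r ?exprn_ge0 // !ler_pM2l.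
Qed.

(** The exit point is the other lift of [x] itself, where the embedding equals [- F x]. *)
Lemma card_lam_near_minus1 delta : ~ bipartite e -> 0 <= delta ->
  #|[set i | 1 + lam i <= delta]|%:R ^+ 3 <= 38 * delta * #|V|%:R ^+ 3.
Proof.
move=> nonbip delta0; apply: (card_embed_bound (s := true)) => // [i|x].
  by rewrite inE expr1 mulN1r opprK.
exists (x, true); first exact: connect_cover_nonbipartite.
by rewrite dotv_lift expr1 mulN1r oppr_le0 normv2_ge0.
Qed.

Lemma sum_deg_psi i : lam i != 1 -> \sum_x (deg e x)%:R * psi i x = 0.
Proof.
move=> l1; have := dotd_transP1 e_sym deg_gt0 (psi i); rewrite P_psi dotdZl.
move/eqP; rewrite -subr_eq0 -{2}[dotd _ _ _]mul1r -mulrBl mulf_eq0 subr_eq0.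
rewrite (_ : 1 = 1%:C) // (inj_eq (@complexI R)) (negPf l1) /= => /eqP h.
rewrite -[RHS]h; apply: eq_bigr => x _.
by rewrite ffunE conjC1 mulr1.
Qed.

(** Eigenvectors for eigenvalues other than 1 have degree-weighted mean 0, so the embedding is
    centered and some [F y] has nonpositive inner product with [F x]; connectivity supplies the path
    to [y]. *)
Lemma card_lam_near_1 delta : 0 <= delta ->
  #|[set i | lam i != 1 & 1 - lam i <= delta]|%:R ^+ 3 <= 38 * delta * #|V|%:R ^+ 3.
Proof.
set S := [set i | _ & _].
move=> delta0; apply: (card_embed_bound (s := false)) => // [i|x].
  by rewrite inE expr0 mul1r => /andP[].
have F0 j : \sum_y (deg e y)%:R * embed S y j = 0.
  rewrite /embed; have [|_] := boolP (j.1 \in S); last first.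
    by rewrite big1 // => y _; rewrite mulr0.
  rewrite inE => /andP[/sum_deg_psi h _]; case: j.2.
    transitivity (complex.Im (\sum_x (deg e x)%:R * psi j.1 x)); last by rewrite h.
  rewrite raddf_sum; apply: eq_bigr => y _.
    by rewrite -(rmorph_nat (real_complex R)); case: (psi _ y) => a b /=; ring.
  transitivity (complex.Re (\sum_x (deg e x)%:R * psi j.1 x)); last by rewrite h.
  rewrite raddf_sum; apply: eq_bigr => y _.
  by rewrite -(rmorph_nat (real_complex R)); case: (psi _ y) => a b /=; ring.
have : \sum_y (deg e y)%:R * dotv (embed S y) (embed S x) = 0.
  under eq_bigr do rewrite mulr_sumr.
  rewrite exchange_big big1 //= => j _.
  under eq_bigr do rewrite mulrA.
  by rewrite -mulr_suml F0 mul0r.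
have [y hy _|pos] := pickP (fun y => dotv (embed S y) (embed S x) <= 0).
  exists (y, false); first exact: connect_coverF.
  by rewrite dotv_lift mul1r.
move=> s0; exfalso; suff : 0 < \sum_y (deg e y)%:R * dotv (embed S y) (embed S x).
  by rewrite s0 ltxx.
have p y : 0 < (deg e y)%:R * dotv (embed S y) (embed S x).
  by rewrite mulr_gt0 ?ltr0n // ltNge pos.
rewrite (bigD1 x) //= ltr_wpDr ?p // sumr_ge0 // => y _; exact: ltW.
Qed.

Lemma psi_const i x y : lam i = 1 -> psi i x = psi i y.
Proof.
move=> l1; have edge u v : e u v -> psi i u = psi i v.
  move=> uv; have := dirichlet_psi false i.
  rewrite l1 mulr1 expr0 subrr mulr0 => /eqP; rewrite psumr_eq0; last first.
    by move=> z _; apply: sumr_ge0 => z' _; exact: sqmod_ge0.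
  move=> /allP/(_ u (mem_index_enum _)) /=; rewrite psumr_eq0; last first.
    by move=> z _; exact: sqmod_ge0.
  move=> /allP/(_ v (mem_index_enum _)); rewrite uv mul1r /= => /eqP h.
  by apply/eqP; rewrite -subr_eq0 -normr_eq0 -sqrf_eq0 normCK mulcJ h.
have /connectP[l xl ->] := e_conn x y.
by elim: l x xl => //= z l IHl x /andP[/edge -> /IHl].
Qed.

(** Existence: otherwise the constant 1 would be orthogonal to the whole basis. Uniqueness: by
    [psi_const] two such eigenvectors would be nonzero constants, which are not orthogonal. *)
Lemma card_lam1 (x0 : V) : #|[set i | lam i == 1]| = 1%N.
Proof.
have [i li] : exists i, lam i == 1.
  apply/existsP; apply: contraT; rewrite negb_exists => /forallP l1.
  have /ffunP/(_ x0) := psi_expand psi_complete ([ffun _ => 1] : l2).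
  rewrite big1 ?ffunE => [/eqP|i _]; first by rewrite oner_eq0.
  rewrite dotdC (_ : dotd e (psi i) _ = 0) ?conjC0 ?scale0r //.
  rewrite -[RHS](sum_deg_psi (l1 i)).
  by apply: eq_bigr => x _; rewrite ffunE conjC1 mulr1.
apply/eqP/cards1P; exists i; apply/setP => j; rewrite !inE.
apply/eqP/eqP => [lj|->]; last exact/eqP.
apply/eqP/negPn/negP => /negPf ij.
pose D : C := \sum_x (deg e x)%:R.
have dE k k' : lam k = 1 -> lam k' = 1 ->
    D * psi k x0 * Num.conj (psi k' x0) = (k == k')%:R.
  move=> lk lk'; rewrite -psi_orth /dotd /D !mulr_suml; apply: eq_bigr => x _.
  by rewrite (psi_const x x0 lk) (psi_const x x0 lk').
have := dE _ _ lj (eqP li); rewrite ij => /eqP; rewrite !mulf_eq0.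
have := dE _ _ lj lj; have := dE _ _ (eqP li) (eqP li); rewrite !eqxx => h1 h2.
case/orP => [/orP[]|] /eqP h0.
- by move: h1; rewrite h0 !mul0r => /esym/eqP; rewrite oner_eq0.
- by move: h2; rewrite h0 mulr0 mul0r => /esym/eqP; rewrite oner_eq0.
by move: h1; rewrite h0 mulr0 => /esym/eqP; rewrite oner_eq0.
Qed.

(** * Return probabilities as power sums of eigenvalues *)

Lemma ptrans_psi t x y : (ptrans R e t x y)%:C =
  \sum_i (lam i)%:C ^+ t * (psi i x * Num.conj (psi i y) * (deg e y)%:R).
Proof.
elim: t x y => [|t IHt] x y /=.
  rewrite rmorph_nat -psi_complete; apply: eq_bigr => i _.
  by rewrite expr0 mul1r.
rewrite rmorph_sum /=.
under eq_bigr do rewrite rmorphM /= IHt mulr_sumr.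
rewrite exchange_big; apply: eq_bigr => i _ /=.
have := congr1 (fun f : l2 => f x) (P_psi i); rewrite lfunE !ffunE /GRing.scale /= => h.
rewrite exprSr -!mulrA [_ * (psi i x * _)]mulrA -h -!mulrA; rewrite [RHS]mulrCA !mulrA.
rewrite mulr_sumr !mulr_suml [LHS](bigID (e x)) /=.
rewrite [X in _ + X]big1 ?addr0 => [|z /negPf xz].
  apply: eq_bigr => z xz; rewrite /step xz fmorphV rmorph_nat; ring.
by rewrite /step xz mul0r.
Qed.

Lemma trace_ptrans t : \sum_x ptrans R e t x x = \sum_i lam i ^+ t.
Proof.
apply: complexI; rewrite !rmorph_sum /=.
under eq_bigr do rewrite ptrans_psi.
rewrite exchange_big; apply: eq_bigr => i _ /=.
rewrite -mulr_sumr rmorphXn /= (_ : \sum_x _ = 1) ?mulr1 //.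
transitivity (dotd e (psi i) (psi i)); last by rewrite psi_orth eqxx.
by apply: eq_bigr => x _; ring.
Qed.

Lemma trace_ptrans_nontrivial (x0 : V) t :
  \sum_x ptrans R e t x x - 1 = \sum_(i | lam i != 1) lam i ^+ t.
Proof.
rewrite trace_ptrans (bigID (fun i => lam i == 1)) /=.
rewrite (eq_bigr (fun _ => 1)) => [|i /eqP ->]; last by rewrite expr1n.
rewrite sumr_const (_ : #|_| = 1%N) ?mulr1n ?[1 + _]addrC ?addrK //.
by rewrite -(card_lam1 x0) cardsE.
Qed.

Hypothesis nonbip : ~ bipartite e.
Variables (N : R) (t : nat).
Hypotheses (N_gt0 : 0 < N) (Nt : N ^+ 3 * t%:R = #|V|%:R ^+ 3).

(** Here [N] stands for [n / t^(1/3)], so that [card_lam_near_1] is the hypothesis of [sum_gap_le]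
    for the gaps [1 - lam i]; the subtracted term is nonnegative and is dropped. *)
Lemma sum_lam_pos : \sum_(i | (lam i != 1) && (0 <= lam i)) lam i ^+ t <= 15 * N.
Proof.
pose S := [set i | (lam i != 1) && (0 <= lam i)].
pose g i := 1 - lam i.
have lam1 i : lam i <= 1.
  have := lam_bound false i.
  by rewrite expr0 mul1r subr_ge0.
have : \sum_(i in S) (1 - g i) ^+ t <= 15 * N - 60 * N ^+ 2 / (4 * N + #|S|%:R).
  apply: sum_gap_le => // i; rewrite inE => /andP[l1 l0].
    by rewrite /g; have := lam1 i; lra.
  have g0 : 0 <= g i by rewrite subr_ge0.
  rewrite Nt; apply: le_trans (card_lam_near_1 g0).
  rewrite ler_pXn2r ?nnegrE // ler_nat subset_leq_card //; apply/subsetP => j.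
  by rewrite !inE => /andP[/andP[-> _]].
have : 0 <= 60 * N ^+ 2 / (4 * N + #|S|%:R).
  have : 0 <= #|S|%:R :> R by [].
  by move=> c0; rewrite divr_ge0 ?mulr_ge0 ?sqr_ge0 ?addr_ge0 ?mulr_ge0 // ltW.
have -> : \sum_(i in S) (1 - g i) ^+ t =
          \sum_(i | (lam i != 1) && (0 <= lam i)) lam i ^+ t.
  by apply: eq_big => [i|i _]; [rewrite inE | rewrite /g opprB addrCA subrr addr0].
by lra.
Qed.

Lemma sum_lam_neg : \sum_(i | lam i < 0) (- lam i) ^+ t <= 15 * N.
Proof.
pose S := [set i | lam i < 0].
pose g i := 1 + lam i.
have g0 i : 0 <= g i.
  have := lam_bound true i.
  by rewrite expr1 mulN1r opprK.
have : \sum_(i in S) (1 - g i) ^+ t <= 15 * N - 60 * N ^+ 2 / (4 * N + #|S|%:R).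
  apply: sum_gap_le => // i; rewrite inE => l0.
    by have := g0 i; rewrite /g; lra.
  rewrite Nt; apply: le_trans (card_lam_near_minus1 nonbip (g0 i)).
  rewrite ler_pXn2r ?nnegrE // ler_nat subset_leq_card //; apply/subsetP => j.
  by rewrite !inE => /andP[].
have : 0 <= 60 * N ^+ 2 / (4 * N + #|S|%:R).
  have : 0 <= #|S|%:R :> R by [].
  by move=> c0; rewrite divr_ge0 ?mulr_ge0 ?sqr_ge0 ?addr_ge0 ?mulr_ge0 // ltW.
have -> : \sum_(i in S) (1 - g i) ^+ t = \sum_(i | lam i < 0) (- lam i) ^+ t.
  by apply: eq_big => [i|i _]; [rewrite inE | rewrite /g opprD addrA subrr add0r].
by lra.
Qed.

Lemma trace_split (x0 : V) : \sum_x ptrans R e t x x - 1 =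
  \sum_(i | (lam i != 1) && (0 <= lam i)) lam i ^+ t +
  (-1) ^+ t * \sum_(i | lam i < 0) (- lam i) ^+ t.
Proof.
rewrite (trace_ptrans_nontrivial x0) (bigID (fun i => 0 <= lam i)) /=.
congr (_ + _); rewrite mulr_sumr; apply: eq_big => [i|i _].
  by rewrite -ltNge; case: ltrP => [l0|]; rewrite ?andbT ?andbF // lt_eqF //
    (lt_trans l0).
by rewrite -exprMn mulN1r opprK.
Qed.

End EigenbasisCounting.

(** * Consequences of non-bipartiteness, and assembly of the bounds *)

Lemma nonbipartite_inhabited (V : finType) (e : rel V) : ~ bipartite e -> inhabited V.
Proof.
move=> nonbip; have [x _|V0] := pickP (@predT V); first exact: inhabits.
by case: nonbip; exists (fun _ => true) => x; have := V0 x.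
Qed.

(** An isolated vertex of a connected graph is its only vertex, and the graph is then trivially
    bipartite. *)
Lemma nonbipartite_deg_gt0 (V : finType) (e : rel V) :
  connected_graph e -> ~ bipartite e -> forall x, (0 < deg e x)%N.
Proof.
move=> conn nonbip x; rewrite lt0n; apply/negP => /eqP /cards0_eq d0.
have ex y : e x y = false by have := in_set0 y; rewrite -d0 inE.
case: nonbip; exists (fun _ => true) => y z.
have /connectP[[|u l] /=] := conn x y; last by rewrite ex.
by move=> _ ->; rewrite ex.
Qed.

Lemma powR_third_cube (R : realType) (x : R) : 0 <= x -> (x `^ (1 / 3)) ^+ 3 = x.
Proof.
by move=> x0; rewrite -powR_mulrn ?powR_ge0 // -powRrM divfK ?powRr1 ?pnatr_eq0.
Qed.

Lemma count_le_nth_sorted (R : rcfType) (s : seq R[i]) k :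
    sorted <=%R s -> (k < size s)%N ->
  (k < count (fun z => z <= nth 0 s k)%R s)%N.
Proof.
move=> ss ks; rewrite -[X in count _ X](cat_take_drop k.+1 s) count_cat.
apply: leq_trans (leq_addr _ _).
have sz : size (take k.+1 s) = k.+1 by rewrite size_takel.
rewrite -[k.+1 in leqLHS]sz eq_leq //; apply/esym/eqP.
rewrite -all_count; apply/(all_nthP 0) => j.
rewrite sz => jk; rewrite nth_take //.
by apply: (sorted_leq_nth le_trans le_refl); rewrite ?inE //; exact: leq_ltn_trans ks.
Qed.

(* On R[i], x <= y (and x < y) means that 'Im x = 'Im y and that the real
   parts are so ordered; hence the first two bounds also say that the spectral
   measure and the eigenvalues are real. *)
Theorem theorem1p6 (R : realType) (V : finType) (e : rel V)
    (e_sym : symmetric e) (e_irr : irreflexive e)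
    (e_conn : connected_graph e) (e_nonbip : ~ bipartite e) :
  [/\ forall delta : R, 0 < delta < 2 ->
        muQ e delta%:C < ((4000 * delta) `^ (1 / 3))%:C,
      forall k : nat, (1 <= k <= #|V|)%N ->
        -1 + (k ^ 3)%:R / (4000 * (#|V| ^ 3)%:R)
          <= nth 0 (eigenvalues (transP R[i] e)) k.-1,
      forall t : nat, (1 <= t)%N -> ~~ odd t ->
        0 <= (\sum_x ptrans R e t x x - 1) / #|V|%:R
          <= 30 / t%:R `^ (1 / 3)
    & forall t : nat, (1 <= t)%N -> odd t ->
        `|\sum_x ptrans R e t x x - 1| / #|V|%:R <= 15 / t%:R `^ (1 / 3)].
Proof.
have deg_gt0 := nonbipartite_deg_gt0 e_conn e_nonbip.
have [x0] := nonbipartite_inhabited e_nonbip.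
have n0 : 0 < #|V|%:R :> R by rewrite ltr0n; apply/card_gt0P; exists x0.
have [psi [lamC [lam_real psi_orth psi_complete]]] :=
  @exists_eigenbasis R[i] V e e_sym deg_gt0.
pose lam i := complex.Re (lamC i).
have lamE i : lamC i = (lam i)%:C by rewrite /lam RRe_real.
move=> P_psiC; have P_psi i : transP R[i] e (psi i) = (lam i)%:C *: psi i.
  by rewrite -lamE.
have near_minus1 delta : 0 <= delta ->
    #|[set i | 1 + lam i <= delta]|%:R ^+ 3 <= 38 * delta * #|V|%:R ^+ 3.
  exact: (card_lam_near_minus1 e_sym e_conn deg_gt0 psi_orth P_psi).
have lam_ge i : 0 <= 1 + lam i.
  have := lam_bound e_sym deg_gt0 psi_orth P_psi true i.
  by rewrite expr1 mulN1r opprK.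
have trace_parts t : (1 <= t)%N -> exists p q : R,
    [/\ 0 <= p <= 15 / t%:R `^ (1 / 3), 0 <= q <= 15 / t%:R `^ (1 / 3) &
        (\sum_x ptrans R e t x x - 1) / #|V|%:R = p + (-1) ^+ t * q].
  move=> t1; have t0 : 0 < t%:R :> R by rewrite ltr0n.
  have r0 : 0 < t%:R `^ (1 / 3) :> R by rewrite powR_gt0.
  pose N : R := #|V|%:R / t%:R `^ (1 / 3).
  have N0 : 0 < N by rewrite divr_gt0.
  have Nt : N ^+ 3 * t%:R = #|V|%:R ^+ 3.
    by rewrite expr_div_n powR_third_cube ?divfK ?gt_eqF // ltW.
  have hpos := sum_lam_pos e_sym e_conn deg_gt0 psi_orth P_psi N0 Nt.
  have hneg := sum_lam_neg e_sym e_conn deg_gt0 psi_orth P_psi e_nonbip N0 Nt.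
  exists (\sum_(i | (lam i != 1) && (0 <= lam i)) lam i ^+ t / #|V|%:R).
  exists (\sum_(i | lam i < 0) (- lam i) ^+ t / #|V|%:R).
  rewrite -!mulr_suml !ler_pdivrMr // ![_ / _ * _]mulrAC -!mulrA -/N hpos hneg !andbT.
  split.
  - by rewrite divr_ge0 // sumr_ge0 // => i /andP[_ l0]; rewrite exprn_ge0.
  - by rewrite divr_ge0 // sumr_ge0 // => i l0; rewrite exprn_ge0 // oppr_ge0 ltW.
  rewrite (trace_split e_sym e_conn deg_gt0 psi_orth psi_complete P_psi t x0).
  by rewrite mulrDl mulrA.
split.
- move=> delta /andP[delta0 _].
  rewrite (muQE deg_gt0 psi_orth psi_complete P_psi).
  (* Since [0 <= 1 + lam i], the window reduces to its upper bound, stated over the reals. *)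
  have -> : [set i | 0 <= 1 + (lam i)%:C <= delta%:C] = [set i | 1 + lam i <= delta].
    apply/setP => i; rewrite !inE -(rmorph1 (real_complex R)) -rmorphD /=.
    by rewrite ler0c lam_ge lecR.
  rewrite -!(rmorph_nat (real_complex R)) -fmorphV -rmorphM ltcR.
  rewrite -(ltr_pXn2r (n := 3)) ?nnegrE ?powR_ge0 ?divr_ge0 //.
  rewrite powR_third_cube; last by rewrite mulr_ge0 // ltW.
  rewrite expr_div_n ltr_pdivrMr ?exprn_gt0 //.
  (* After cubing, strictness comes from [38 < 4000]. *)
  apply: le_lt_trans (near_minus1 _ (ltW delta0)) _.
  by rewrite ltr_pM2r ?exprn_gt0 // ltr_pM2r // ltr_nat.
- move=> k /andP[k1 kn].
  have perm := perm_eigenvalues_basis psi_orth P_psi.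
  set s := eigenvalues _ in perm *.
  have size_s : size s = #|V| by rewrite (perm_size perm) size_map size_enum_ord.
  have ks : (k.-1 < size s)%N by rewrite size_s prednK.
  have s_real : {subset s <= Num.real}.
    move=> z; rewrite (perm_mem perm) => /mapP[i _ ->].
    by apply/complex_realP; exists (lam i).
  (* Sorting by a partial order yields a sorted list here because all the eigenvalues are real. *)
  have ss : sorted <=%R s.
    rewrite /s /eigenvalues; apply: (sort_sorted_in (P := Num.real)).
      by move=> a b; exact: real_leVge.
    by apply/allP => z zs; apply: s_real; rewrite mem_sort.
  have [i _ zE] : exists2 i, i \in enum 'I_#|V| & nth 0 s k.-1 = (lam i)%:C.
    by apply/mapP; rewrite -(perm_mem perm) mem_nth.
  have := count_le_nth_sorted ss ks; rewrite zE (permP perm) count_map.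
  rewrite prednK // => kc.
  have {}kc : (k <= #|[set j | (1 + lam j <= 1 + lam i)%R]|)%N.
    apply: leq_trans kc _; rewrite -sum1_count big_enum_cond /= -sum1dep_card.
    by apply/eq_leq/eq_bigl => j; rewrite /= lecR lerD2l.
  (* The window is taken as [1 + lam i], with [lam i] the [k]-th smallest eigenvalue (index [k.-1]),
     so that it contains at least [k] eigenvalues. *)
  have h := near_minus1 _ (lam_ge i).
  have {}h : k%:R ^+ 3 <= 38 * (1 + lam i) * #|V|%:R ^+ 3.
    by apply: le_trans h; rewrite ler_pXn2r ?nnegrE // ler_nat.
  have n3 : 0 < #|V|%:R ^+ 3 :> R by rewrite exprn_gt0.
  rewrite [leLHS](_ : _ = (-1 + k%:R ^+ 3 / (4000 * #|V|%:R ^+ 3))%:C); last first.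
    rewrite !natrX rmorphD rmorphN1 fmorph_div /= rmorphXn.
    by rewrite [X in _ = _ + _ / X]rmorphM /= rmorphXn /= !rmorph_nat.
  rewrite lecR -lerBrDl opprK addrC ler_pdivrMr; last by rewrite mulr_gt0.
  apply: le_trans h _.
  rewrite [leRHS](_ : _ = 4000 * (1 + lam i) * #|V|%:R ^+ 3); last by ring.
  by rewrite ler_wpM2r ?(ltW n3) // ler_wpM2r ?ler_nat.
(* For even [t] the two halves, each in the interval from 0 to [15 / t^(1/3)], add up. *)
- move=> t t1 t_even; have [p [q [p_bound q_bound ->]]] := trace_parts t t1.
  by rewrite -signr_odd (negPf t_even) expr0 mul1r; lra.
(* For odd [t] they are subtracted, and the difference stays within the bound of a single half. *)
move=> t t1 t_odd; have [p [q [p_bound q_bound tr]]] := trace_parts t t1.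
rewrite -(ger0_norm (ltW n0)) -normf_div tr -signr_odd t_odd expr1 mulN1r.
by rewrite ler_norml; lra.
Qed.
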